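(* Let $t\ge 1$ and $0\le t'\le t$ be integers, let $\ell_1,\dots,\ell_t$ be positive integers with $\ell_i\ge 2$ for at least one $i$, and let $\kappa_1,\dots,\kappa_t$ be positive reals. Define $s_0=1$ and, for $n\ge 1$, \[ s_n=\sum_{i=1}^{t'}\ \sum_{x_1+\dots+x_{\ell_i}=n-1} \kappa_i\, s_{x_1}\cdots s_{x_{\ell_i}} \;+\; \sum_{i=t'+1}^{t}\ \max_{x_1+\dots+x_{\ell_i}=n-1} \kappa_i\, s_{x_1}\cdots s_{x_{\ell_i}}, \] where all $x_j$ range over nonnegative integers. Let $\lambda=\lim_{n\to\infty}\sqrt[n]{s_n}$ (this limit exists). Let $\mathcal L=\max_i \ell_i$ and let $\kappa^*=\kappa_i$ for some $i$ with $\ell_i\ge 2$. Then for every $n\ge 2$, \[ \sqrt[n]{\frac{\kappa^*}{\mathcal L(n-1) s_1} s_n} \le \lambda \le \sqrt[n]{3^{18\log 3 + 2\log\frac{s_1\mathcal L^2}{\kappa^*}}\; n^{3\log n + 12\log 3 + \log\frac{s_1\mathcal L^2}{\kappa^*}}\; s_n}, \] where $\log$ denotes the logarithm to the base $\frac{\mathcal L+1}{\mathcal L}$.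
   Context: The first $t'$ terms of the recurrence use summation and the remaining $t-t'$ terms use maximum over all tuples of nonnegative integers $(x_1,\dots,x_{\ell_i})$ with the given sum. The existence of the limit $\lambda$ is established in the paper. *)

(* Defs.v *)
From mathcomp Require Import all_boot all_order all_algebra.
From mathcomp Require Import all_classical all_reals all_analysis.
Set Implicit Arguments.
Unset Strict Implicit.
Unset Printing Implicit Defensive.
Import Order.TTheory GRing.Theory Num.Theory.
Local Open Scope ring_scope.

(* The l-tuples of nonnegative integers summing to n; every entry of such a
   tuple is at most n, so bounding the entries by 'I_n.+1 loses nothing. *)
Definition compositions (l n : nat) : {set {ffun 'I_l -> 'I_n.+1}} :=
  [set x : {ffun 'I_l -> 'I_n.+1} | (\sum_(j < l) x j == n)%N].

(* The value of s_(n+1) computed from the earlier terms.  When l >= 1 the set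
   compositions l n is nonempty, and all the products below are positive along
   the sequence, so the default value 0 of the maximum plays no role. *)
Definition next_term (R : realType) (t t' : nat) (ell : 'I_t -> nat)
    (kappa : 'I_t -> R) (s : nat -> R) (n : nat) : R :=
  \sum_(i < t | (i < t')%N) \sum_(x in compositions (ell i) n)
     kappa i * \prod_(j < ell i) s (x j)
  + \sum_(i < t | (t' <= i)%N) \big[Num.max/0]_(x in compositions (ell i) n)
     (kappa i * \prod_(j < ell i) s (x j)).

Definition satisfies_recurrence (R : realType) (t t' : nat)
    (ell : 'I_t -> nat) (kappa : 'I_t -> R) (s : nat -> R) : Prop :=
  s 0%N = 1 /\
  forall n, (1 <= n)%N -> s n = next_term t' ell kappa s n.-1.

Definition nroot (R : realType) (n : nat) (x : R) : R := x `^ n%:R^-1.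

Definition logb (R : realType) (b x : R) : R := ln x / ln b.

Lemma next_term_local (R : realType) (t t' : nat) (ell : 'I_t -> nat)
    (kappa : 'I_t -> R) (s s' : nat -> R) (n : nat) :
  (forall k, (k <= n)%N -> s k = s' k) ->
  next_term t' ell kappa s n = next_term t' ell kappa s' n.
Proof.
move=> ss'; have prodE i (x : {ffun 'I_(ell i) -> 'I_n.+1}) :
    \prod_(j < ell i) s (x j) = \prod_(j < ell i) s' (x j).
  by apply: eq_bigr => j _; rewrite ss' // -ltnS.
by congr (_ + _); apply: eq_bigr => i _; apply: eq_bigr => x _; rewrite prodE.
Qed.

Lemma recurrence_uniq (R : realType) (t t' : nat) (ell : 'I_t -> nat)
    (kappa : 'I_t -> R) (s s' : nat -> R) :
  satisfies_recurrence t' ell kappa s ->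
  satisfies_recurrence t' ell kappa s' -> s =1 s'.
Proof.
move=> [s0 sS] [s'0 s'S] n; elim/ltn_ind: n => -[|n] IHn; first by rewrite s0.
by rewrite sS // s'S //; apply: next_term_local => k le_kn; apply: IHn.
Qed.

Lemma recurrence_ex (R : realType) (t t' : nat) (ell : 'I_t -> nat)
    (kappa : 'I_t -> R) : exists s, satisfies_recurrence t' ell kappa s.
Proof.
pose tab := fix tab n : nat -> R := if n is m.+1 then
  fun k => if (k <= m)%N then tab m k else next_term t' ell kappa (tab m) m
  else fun=> 1.
have tabE n k : (k <= n)%N -> tab n k = tab k k.
  elim: n => [|n IHn]; first by rewrite leqn0 => /eqP->.
  by rewrite leq_eqVlt => /predU1P[->//|lekn]; rewrite /= -ltnS lekn IHn.
exists (fun n => tab n n); split=> // -[//|n] _ /=; rewrite ltnn.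
by apply: next_term_local => k; apply: tabE.
Qed.

(* Main.v *)
(* The number [s n] is the total weight of rooted ordered trees with [n] internal
   vertices (with maxima in place of some of the sums), and the proof cuts and
   glues trees, in terms of the recurrence.  Put [k = kappa i0] and
   [c = s 1 * L ^ 2 / k].
   - Hanging two trees below a vertex of type [i0] gives
     [k * s m * s n <= s (m + n + 1)], so [k * s (n - 1)] is supermultiplicative
     and Fekete's lemma gives [k * s (n - 1) <= lambda ^ n]; deleting a lowest
     internal vertex gives [s n <= L * (n - 1) * s 1 * s (n - 1)].  Together these
     are the lower bound.
   - Going down to the largest child until the subtree has at most
     [L * N / (L + 1)] of the [N] internal vertices cuts a tree into two pieces
     whose sizes are at most about [L * N / (L + 1)].  One of them is cut
     recursively so that everything can be glued back into trees with [m] and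
     [n] internal vertices, [m + n = N].  Each of the [log N + 1] rounds costs a
     factor [c * N ^ 3], hence [s (2 * n) <= (c * N ^ 3) ^ (log N + 1) * s n ^ 2]
     with [N = 2 * n].  Iterating [n -> 2 * n] gives the upper bound, and also the
     finiteness of [lambda]. *)
Require Import Defs.
From mathcomp Require Import all_boot all_order all_algebra.
From mathcomp Require Import all_classical all_reals all_analysis.
From mathcomp Require Import zify ring lra.
Set Implicit Arguments.
Unset Strict Implicit.
Unset Printing Implicit Defensive.
Import Order.TTheory GRing.Theory Num.Theory.
Import numFieldNormedType.Exports.
Local Open Scope classical_set_scope.
Local Open Scope ring_scope.

(** * Compositions, and lowering one of their entries *)

Lemma compositionsP (l n : nat) (x : {ffun 'I_l -> 'I_n.+1}) :
  reflect (\sum_(j < l) x j = n)%N (x \in compositions l n).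
Proof. by rewrite inE; apply: eqP. Qed.

Lemma composition_le2 (l n : nat) (x : {ffun 'I_l -> 'I_n.+1}) (j k : 'I_l) :
  x \in compositions l n -> k != j -> (x k + x j <= n)%N.
Proof.
move=> /compositionsP xn kj; rewrite -[leqRHS]xn (bigD1 k) //= (bigD1 j) 1?eq_sym //=.
by rewrite addnA leq_addr.
Qed.

Lemma composition_ex_large (l n : nat) (x : {ffun 'I_l -> 'I_n.+1}) :
  (0 < l)%N -> x \in compositions l n -> exists j, (n <= l * x j)%N.
Proof.
move=> l0 /compositionsP xn; apply/not_existsP => H.
have : (\sum_(j < l) l * x j < \sum_(j < l) n)%N.
  have le j : (l * x j <= n)%N by move: (H j) => /negP; lia.
  rewrite (bigD1 (Ordinal l0)) // [ltnRHS](bigD1 (Ordinal l0)) //=.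
  rewrite -addSn leq_add //; first by move: (H (Ordinal l0)) => /negP; lia.
  by apply: leq_sum => i _; apply: le.
by rewrite -big_distrr /= xn sum_nat_const card_ord ltnn.
Qed.

(** Detaches [a] vertices from the [j]-th child. [inord] loses nothing when [x] is a composition of
    [n] and [a <= x j]. *)
Definition shrink (l n a : nat) (j : 'I_l) (x : {ffun 'I_l -> 'I_n.+1}) :
    {ffun 'I_l -> 'I_(n - a).+1} :=
  [ffun k => inord (x k - a * (k == j))].

Lemma val_shrink (l n a : nat) (j k : 'I_l) (x : {ffun 'I_l -> 'I_n.+1}) :
  x \in compositions l n -> (a <= x j)%N ->
  shrink a j x k = (x k - a * (k == j))%N :> nat.
Proof.
move=> xn axj; rewrite ffunE inordK // ltnS.
have [->|kj] := eqVneq k j; first by rewrite muln1 leq_sub2r // -ltnS.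
by rewrite muln0 subn0; have := composition_le2 xn kj; lia.
Qed.

Lemma shrink_composition (l n a : nat) (j : 'I_l) (x : {ffun 'I_l -> 'I_n.+1}) :
  x \in compositions l n -> (a <= x j)%N ->
  shrink a j x \in compositions l (n - a).
Proof.
move=> xn axj; apply/compositionsP.
under eq_bigr do rewrite val_shrink //.
move/compositionsP: xn => xn; rewrite -[in RHS]xn [in RHS](bigD1 j) //=.
rewrite (bigD1 j) //= eqxx muln1 addnBAC //; congr (_ + _ - _)%N.
by apply: eq_bigr => i /negPf ->; rewrite muln0 subn0.
Qed.

Lemma shrink_inj (l n a : nat) (j : 'I_l) :
  {in [set x in compositions l n | (a <= x j)%N] &,
    injective (@shrink l n a j)}.
Proof.
move=> x y; rewrite !inE -!(rwP andP) => -[/eqP/compositionsP xn ax].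
move=> -[/eqP/compositionsP yn ay] /ffunP xy; apply/ffunP => k; apply/val_inj.
have := congr1 val (xy k); rewrite /= !val_shrink //.
have [->|_] := eqVneq k j; rewrite ?muln0 ?muln1 ?subn0 //= => e.
by rewrite -(subnK ax) e subnK.
Qed.

Lemma prod_shrink (R : realType) (s : nat -> R) (l n a : nat) (j : 'I_l)
    (x : {ffun 'I_l -> 'I_n.+1}) :
  x \in compositions l n -> (a <= x j)%N ->
  \prod_k s (shrink a j x k) = s (x j - a)%N * \prod_(k | k != j) s (x k).
Proof.
move=> xn axj; rewrite (bigD1 j) //= val_shrink // eqxx muln1; congr (_ * _).
by apply: eq_bigr => k /negPf kj; rewrite val_shrink // kj muln0 subn0.
Qed.

(** * Detaching a subtree below one vertex *)

(* The maximal number of leaves of a tree with [k] internal vertices, each of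
   which has at most [L >= 1] children. *)
Definition leaves (L k : nat) : nat := (1 + L.-1 * k)%N.

(** The children's leaves are those of the whole tree: [l + (L - 1) * n <= 1 + (L - 1) * (n + 1)]
    since [l <= L]. *)
Lemma sum_leaves_composition (L l n : nat) (x : {ffun 'I_l -> 'I_n.+1}) :
  (l <= L)%N -> x \in compositions l n ->
  (\sum_j leaves L (x j) <= leaves L n.+1)%N.
Proof.
move=> lL /compositionsP xn; rewrite /leaves big_split /= -big_distrr /= xn.
by rewrite sum_nat_const card_ord muln1; nia.
Qed.

(* A subtree with [a] internal vertices is detached from a tree with [N]: the one
   reached by descending to the largest child until at most [M] vertices remain,
   so that [a <= M] while its parent has more than [M]. *)
Definition splits (R : realType) (L M : nat) (s : nat -> R) (N : nat) : Prop :=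
  s N <= \sum_(a < M.+1 | (M <= L * a)%N)
    (leaves L (N - a))%:R * (s a * s (N - a)%N).

(** A child [j] of at least average size is chosen. If [x j <= M], it is detached whole ([a = x j]),
    leaving one leaf; otherwise the split of [s (x j)] applies. *)
Lemma prod_split (R : realType) (L M l n : nat) (s : nat -> R)
    (x : {ffun 'I_l -> 'I_n.+1}) :
  s 0%N = 1 -> (forall k, 0 <= s k) -> (0 < l)%N -> (l <= L)%N -> (M <= n)%N ->
  (forall k, (M < k)%N -> (k <= n)%N -> splits L M s k) ->
  x \in compositions l n ->
  exists j, \prod_k s (x k) <=
    \sum_(a < M.+1 | (M <= L * a)%N && (a <= x j)%N)
      (leaves L (x j - a))%:R * (s a * \prod_k s (shrink a j x k)).
Proof.
move=> s0 sge0 l0 lL Mn IH xn.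
have [j nxj] := composition_ex_large l0 xn; exists j.
have rest0 : 0 <= \prod_(k | k != j) s (x k) by apply: prodr_ge0.
rewrite (bigD1 j) //=; have [xM|Mx] := leqP (x j) M.
  rewrite (bigD1 (Ordinal (xM : (x j < M.+1)%N))) /=; last by apply/andP; nia.
  rewrite prod_shrink // subnn s0 mul1r /leaves muln0 mul1r lerDl.
  apply: sumr_ge0 => a _; rewrite mulr_ge0 ?ler0n // mulr_ge0 //.
  by apply: prodr_ge0.
have xjn : (x j <= n)%N by rewrite -ltnS.
apply: (le_trans (ler_wpM2r rest0 (IH _ Mx xjn))).
rewrite mulr_suml [leRHS](eq_bigl (fun a : 'I_M.+1 => (M <= L * a)%N)).
  apply: ler_sum => a _; rewrite prod_shrink -?mulrA //.
  by have := ltn_ord a; lia.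
by move=> a /=; rewrite (_ : (a <= x j)%N) ?andbT //; have := ltn_ord a; lia.
Qed.

(** Puts the summed and the maximized terms under a single sum over [i]. *)
Definition child_term (R : realType) (summed : bool) (kappa : R) (l : nat)
    (s : nat -> R) (n : nat) : R :=
  if summed then \sum_(x in compositions l n) kappa * \prod_j s (x j)
  else \big[Num.max/0]_(x in compositions l n) (kappa * \prod_j s (x j)).

Lemma next_termE (R : realType) (t t' : nat) (ell : 'I_t -> nat)
    (kappa : 'I_t -> R) (s : nat -> R) (n : nat) :
  next_term t' ell kappa s n =
  \sum_(i < t) child_term (i < t')%N (kappa i) (ell i) s n.
Proof.
rewrite /next_term [RHS](bigID (fun i : 'I_t => (i < t')%N)) /=; congr (_ + _).
  by apply: eq_bigr => i /= it; rewrite /child_term it.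
under eq_bigl do rewrite leqNgt.
by apply: eq_bigr => i /= /negPf it; rewrite /child_term it.
Qed.

Lemma child_term_ge (R : realType) (summed : bool) (kappa : R) (l n : nat)
    (s : nat -> R) (x : {ffun 'I_l -> 'I_n.+1}) :
  0 <= kappa -> (forall k, 0 <= s k) -> x \in compositions l n ->
  kappa * \prod_j s (x j) <= child_term summed kappa l s n.
Proof.
move=> k0 s0 xn; rewrite /child_term; case: summed; last exact: le_bigmax_cond.
rewrite (bigD1 x) //= lerDl; apply: sumr_ge0 => y _.
by rewrite mulr_ge0 // prodr_ge0.
Qed.

Lemma child_term_ge0 (R : realType) (summed : bool) (kappa : R) (l n : nat)
    (s : nat -> R) :
  0 <= kappa -> (forall k, 0 <= s k) -> 0 <= child_term summed kappa l s n.
Proof.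
move=> k0 s0; rewrite /child_term; case: summed; last exact: bigmax_ge_id.
by apply: sumr_ge0 => y _; rewrite mulr_ge0 // prodr_ge0.
Qed.

Lemma leq_leaves (L : nat) : {homo leaves L : m n / (m <= n)%N}.
Proof. by move=> m n mn; rewrite leq_add2l leq_mul2l mn orbT. Qed.

(** Reindexing along the injective [shrink a j]; [f] will count the leaves of what remains of the
    child. *)
Lemma sum_shrink (R : realType) (s : nat -> R) (f : nat -> R) (l n a : nat)
    (j : 'I_l) :
  (forall k, 0 <= s k) -> (forall k, 0 <= f k) ->
  \sum_(x in compositions l n | (a <= x j)%N)
     f (x j - a)%N * \prod_k s (shrink a j x k) <=
  \sum_(y in compositions l (n - a)) f (y j) * \prod_k s (y k).
Proof.
move=> s0 f0; pose A := [set x in compositions l n | (a <= x j)%N]%SET.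
pose F (y : {ffun 'I_l -> 'I_(n - a).+1}) := f (y j) * \prod_k s (y k).
have F0 y : 0 <= F y by rewrite mulr_ge0 // prodr_ge0.
rewrite (eq_bigr (fun x => F (shrink a j x))); last first.
  by move=> x /andP[xn ax]; rewrite /F val_shrink // eqxx muln1.
rewrite (eq_bigl (fun x => x \in A)) => [|x]; last by rewrite !inE.
rewrite -(big_imset F (@shrink_inj l n a j)) /=.
rewrite [leRHS](big_setID (shrink a j @: A)) /= (finset.setIidPr _).
  by rewrite lerDl; apply: sumr_ge0 => y _; apply: F0.
apply/fintype.subsetP => y /imsetP[x xA ->]; move: xA; rewrite inE => /andP[xn ax].
exact: shrink_composition.
Qed.

(** For a maximum, one child [j] per [x] suffices, and its leaves are at most those of the whole
    tree. For a sum, [j] varies with [x], so all [j] are summed and the children's leaf counts add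
    up. *)
Lemma child_term_split (R : realType) (summed : bool) (kappa : R)
    (L M l n : nat) (s : nat -> R) :
  0 <= kappa -> s 0%N = 1 -> (forall k, 0 <= s k) ->
  (0 < l)%N -> (l <= L)%N -> (M <= n)%N ->
  (forall k, (M < k)%N -> (k <= n)%N -> splits L M s k) ->
  child_term summed kappa l s n <=
    \sum_(a < M.+1 | (M <= L * a)%N)
      (leaves L (n.+1 - a))%:R * (s a * child_term summed kappa l s (n - a)).
Proof.
move=> k0 s0 sge0 l0 lL Mn IH.
have P0 m (y : {ffun 'I_l -> 'I_m.+1}) : 0 <= \prod_k s (y k) by apply: prodr_ge0.
have aM (a : 'I_M.+1) : (a <= n)%N by rewrite (leq_trans _ Mn) // -ltnS.
have term0 a b : 0 <= (leaves L a)%:R * (s b * child_term summed kappa l s (n - b)).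
  by rewrite mulr_ge0 ?ler0n // mulr_ge0 // child_term_ge0.
case: summed term0 => term0; last first.
  apply: bigmax_le => [|x xn]; first by apply: sumr_ge0.
  have [j le_j] := prod_split s0 sge0 l0 lL Mn IH xn.
  apply: (le_trans (ler_wpM2l k0 le_j)); rewrite mulr_sumr.
  rewrite [leRHS](bigID (fun a : 'I_M.+1 => (a <= x j)%N)) /=.
  rewrite -[leLHS]addr0 lerD ?sumr_ge0 //; apply: ler_sum => a /andP[_ ax].
  rewrite mulrCA ler_pM ?ler0n ?mulr_ge0 //.
    by rewrite ler_nat leq_leaves // leq_sub2r // ltnW.
  rewrite mulrCA ler_wpM2l //.
  exact: (child_term_ge false k0 sge0 (shrink_composition xn ax)).
rewrite /child_term -big_distrr /=.
have -> : \sum_(a < M.+1 | (M <= L * a)%N) (leaves L (n.+1 - a))%:R *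
    (s a * \sum_(y in compositions l (n - a)) kappa * \prod_k s (y k)) =
  kappa * \sum_(a < M.+1 | (M <= L * a)%N) s a *
     \sum_(y in compositions l (n - a))
       (leaves L (n.+1 - a))%:R * \prod_k s (y k).
  rewrite mulr_sumr; apply: eq_bigr => a _; rewrite -!mulr_sumr.
  by ring.
rewrite ler_wpM2l //.
have le_x x : x \in compositions l n -> \prod_k s (x k) <=
    \sum_j \sum_(a < M.+1 | (M <= L * a)%N && (a <= x j)%N)
      (leaves L (x j - a))%:R * (s a * \prod_k s (shrink a j x k)).
  move=> xn; have [j le_j] := prod_split s0 sge0 l0 lL Mn IH xn.
  apply: (le_trans le_j); rewrite [leRHS](bigD1 j) //= lerDl.
  by apply: sumr_ge0 => i _; apply: sumr_ge0 => a _; rewrite mulr_ge0 ?ler0n // mulr_ge0.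
apply: (le_trans (ler_sum _ le_x)).
rewrite exchange_big /=.
under eq_bigr => j _.
  under eq_bigr do rewrite big_mkcondr /=.
  rewrite exchange_big /=.
  under eq_bigr do rewrite -big_mkcondr /=.
  over.
rewrite exchange_big /=; apply: ler_sum => a _.
apply: (@le_trans _ _ (\sum_(j < l) s a *
   \sum_(y in compositions l (n - a)) (leaves L (y j))%:R * \prod_k s (y k))).
  apply: ler_sum => j _; under eq_bigr do rewrite mulrCA.
  rewrite -mulr_sumr ler_wpM2l //.
  exact: (sum_shrink (f := fun k => (leaves L k)%:R)).
rewrite -mulr_sumr ler_wpM2l // exchange_big /=; apply: ler_sum => y yn.
rewrite -mulr_suml ler_wpM2r // -natr_sum ler_nat.
by rewrite subSn // sum_leaves_composition.
Qed.

(** * Superadditive sequences *)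

(* Euclidean division [n = q * m + r] and [g n >= q * g m + g r]. *)
Lemma superadditive_lower (R : realType) (g : nat -> R) (m : nat) :
  (forall p q, (0 < p)%N -> (0 < q)%N -> g p + g q <= g (p + q)%N) ->
  (0 < m)%N ->
  exists B, forall n, (0 < n)%N -> n%:R * (g m / m%:R) - B <= g n.
Proof.
move=> gD m0; have mR : 0 < m%:R :> R by rewrite ltr0n.
have gM q : (0 < q)%N -> q%:R * g m <= g (q * m)%N.
  elim: q => [//|[|q] IH _]; first by rewrite mul1r mul1n.
  rewrite [(q.+2 * m)%N]mulSn -natr1 mulrDl mul1r addrC.
  apply: le_trans (gD _ _ _ _) => //; last by rewrite muln_gt0.
  by rewrite lerD2l IH.
pose S := \sum_(r < m) `|g r|.
have gS r : (r < m)%N -> - S <= g r.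
  move=> rm; rewrite lerNl; apply: (@le_trans _ _ `|g r|).
    by rewrite -normrN ler_norm.
  by rewrite /S (bigD1 (Ordinal rm)) //= lerDl sumr_ge0.
have S0 : 0 <= S by apply: sumr_ge0.
exists (`|g m| + S) => n n0.
pose q := (n %/ m)%N; pose r := (n %% m)%N.
have nE : n = (q * m + r)%N by apply: divn_eq.
have rm : (r < m)%N by apply: ltn_pmod.
have gn : q%:R * g m - S <= g n.
  have [q0|q0] := posnP q.
    by rewrite q0 mul0r add0r nE q0 mul0n add0n gS.
  have [r0|r0] := posnP r.
    by rewrite nE r0 addn0; apply: (le_trans _ (gM _ q0)); rewrite gerBl.
  by rewrite nE; apply: le_trans (gD _ _ _ _); rewrite ?muln_gt0 ?q0 // lerD ?gM ?gS.
apply: le_trans gn; rewrite [in leLHS]nE natrD natrM mulrDl.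
have -> : q%:R * m%:R * (g m / m%:R) = q%:R * g m by field; rewrite gt_eqF.
rewrite opprD !addrA lerD2r -addrA gerDl subr_le0.
rewrite mulrCA; apply: (le_trans (ler_wpM2r _ (ler_norm _))).
  by rewrite divr_ge0.
by rewrite ler_piMr // ler_pdivrMr // mul1r ler_nat ltnW.
Qed.

(** If the slope [g m / m] exceeded [C], the linear lower bound would outgrow [C] along the indices
    [2 ^ k * n]. *)
Lemma superadditive_le (R : realType) (g : nat -> R) (n : nat) (C : R) :
  (forall p q, (0 < p)%N -> (0 < q)%N -> g p + g q <= g (p + q)%N) ->
  (0 < n)%N -> (forall k, g (2 ^ k * n)%N <= C * (2 ^ k * n)%:R) ->
  forall m, (0 < m)%N -> g m / m%:R <= C.
Proof.
move=> gD n0 gC m m0; have [B gB] := superadditive_lower gD m0.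
rewrite leNgt; apply/negP => Cg.
pose e := g m / m%:R - C; have e0 : 0 < e by rewrite subr_gt0.
have := gB (2 ^ Num.bound `|B / e| * n)%N; rewrite muln_gt0 expn_gt0 n0 => /(_ isT).
set k := Num.bound _; move=> /le_trans/(_ (gC k)).
rewrite lerBlDr -lerBlDl mulrC -mulrBl -/e => le_B.
have : B / e < k%:R.
  apply: le_lt_trans (ler_norm _) _; exact: archi_boundP.
rewrite ltNge => /negP; apply; rewrite ler_pdivlMr // (le_trans _ le_B) //.
rewrite mulrC (ler_wpM2l (ltW e0)) // ler_nat.
by rewrite (leq_trans (ltnW (ltn_expl k (ltnSn 1)))) // leq_pmulr.
Qed.

(** Fekete's lemma; the limit is the supremum of the quotients. *)
Lemma superadditive_cvg (R : realType) (g : nat -> R) (C : R) :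
  (forall p q, (0 < p)%N -> (0 < q)%N -> g p + g q <= g (p + q)%N) ->
  (forall m, (0 < m)%N -> g m / m%:R <= C) ->
  exists rho, [/\ (fun n => g n / n%:R) @ \oo --> rho,
    forall m, (0 < m)%N -> g m / m%:R <= rho &
    forall D, (forall m, (0 < m)%N -> g m / m%:R <= D) -> rho <= D].
Proof.
move=> gD gC; pose E := [set g m / m%:R | m in [set m | (0 < m)%N]].
have E0 : E !=set0 by exists (g 1%N / 1%:R); exists 1%N.
have ubE : has_ubound E by exists C => _ [m m0 <-]; apply: gC.
have supE : has_sup E by split.
have gE m : (0 < m)%N -> g m / m%:R <= sup E.
  by move=> m0; apply: ub_le_sup => //; exists m.
exists (sup E); split => //; last first.
  by move=> D gD'; apply: ge_sup => // _ [m m0 <-]; apply: gD'.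
apply/cvgrPdist_le => e e0.
have [_ [m m0 <-] lt_m] := sup_adherent (divr_gt0 e0 (ltr0n _ 2)) supE.
have [B gB] := superadditive_lower gD m0.
exists (Num.bound `|B / (e / 2)|).+1 => // n /= nB.
have n0 : (0 < n)%N by apply: leq_ltn_trans nB.
have nR : 0 < n%:R :> R by rewrite ltr0n.
rewrite ger0_norm ?subr_ge0 ?gE // lerBlDr -lerBlDl.
rewrite ler_pdivlMr //; apply: le_trans (gB _ n0).
have Bn : B <= e / 2 * n%:R.
  rewrite mulrC -ler_pdivrMr ?divr_gt0 //; apply: (le_trans (ler_norm _)).
  by apply/ltW/(lt_le_trans (archi_boundP (normr_ge0 _))); rewrite ler_nat ltnW.
have : (sup E - e / 2) * n%:R <= n%:R * (g m / m%:R).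
  by rewrite mulrC ler_wpM2l ?ler0n // ltW.
by lra.
Qed.

(** * The exponents of the upper bound *)

(** Used with [x = ln n], [l = ln 2], [T = ln 3], [C = ln c], [beta = ln b]; [h x] is then the
    logarithm of the factor before [s n]. The coefficients 3, 12, 18 let [2 * h x] absorb the cost
    of one doubling. *)
Lemma rate_doubling (R : realFieldType) (x l T beta C : R) :
  0 < beta -> 0 <= l -> 0 <= x -> 0 <= C -> beta <= T - l ->
  let h y := (T * (18 * T + 2 * C) + y * (3 * y + 12 * T + C)) / beta in
  (C + 3 * (l + x)) * (l + x + beta) / beta + h (l + x) <= 2 * h x.
Proof.
move=> b0 l0 x0 C0 bT /=.
have w0 : 0 <= T - l - beta by rewrite subr_ge0.
rewrite -mulrDl mulrA ler_pM2r ?invr_gt0 // -subr_ge0.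
(* The difference is a nonnegative combination of products of [x], [l], [C], [beta], [T - l] and
   [T - l - beta]. *)
have -> : 2 * (T * (18 * T + 2 * C) + x * (3 * x + 12 * T + C)) -
   ((C + 3 * (l + x)) * (l + x + beta) +
    (T * (18 * T + 2 * C) + (l + x) * (3 * (l + x) + 12 * T + C))) =
   x * (12 * (T - l - beta) + 9 * beta) + C * (2 * (T - l - beta) + beta) +
   (6 * (T - l - beta) * (3 * (T - l) + 4 * l) + beta * (18 * (T - l) + 21 * l)).
  by ring.
have u0 : 0 <= T - l by apply: le_trans bT; apply: ltW.
move: (T - l - beta) (T - l) (ltW b0) w0 u0 => w u {}b0 w0 u0.
have := (mulr_ge0 x0 w0, mulr_ge0 x0 b0, mulr_ge0 C0 w0, mulr_ge0 C0 b0).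
have := (mulr_ge0 w0 u0, mulr_ge0 w0 l0, mulr_ge0 b0 u0, mulr_ge0 b0 l0).
by move=> [[[? ?] ?] ?] [[[? ?] ?] ?]; lra.
Qed.

Lemma composition_pair (R : realType) (s : nat -> R) (l m n : nat) :
  s 0%N = 1 -> (2 <= l)%N ->
  exists2 x, x \in compositions l (m + n) & \prod_j s (x j) = s m * s n.
Proof.
move=> s0 l2; pose j0 : 'I_l := Ordinal (ltnW l2); pose j1 : 'I_l := Ordinal l2.
pose x : {ffun 'I_l -> 'I_(m + n).+1} :=
  [ffun j => inord (if j == j0 then m else if j == j1 then n else 0)].
have xE j : x j = (if j == j0 then m else if j == j1 then n else 0)%N :> nat.
  by rewrite ffunE inordK //; case: ifP => _; last case: ifP => _; lia.
have j10 : j1 != j0 by [].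
exists x.
  apply/compositionsP; rewrite (bigD1 j0) //= (bigD1 j1) //= !xE eqxx (negPf j10).
  rewrite eqxx big1 ?addn0 // => j /andP[/negPf jj0 /negPf jj1].
  by rewrite xE jj0 jj1.
rewrite (bigD1 j0) //= (bigD1 j1) //= !xE eqxx (negPf j10) eqxx big1 ?mulr1 //.
by move=> j /andP[/negPf jj0 /negPf jj1]; rewrite xE jj0 jj1.
Qed.

(** * Joining and cutting along the recurrence *)

Section Recurrence.
Variables (R : realType) (t t' : nat) (ell : 'I_t -> nat) (kappa : 'I_t -> R).
Variable s : nat -> R.
Hypothesis ell_gt0 : forall i, (0 < ell i)%N.
Hypothesis kappa_gt0 : forall i, 0 < kappa i.
Hypothesis s_rec : satisfies_recurrence t' ell kappa s.
Variable i0 : 'I_t.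
Hypothesis ell_i0 : (2 <= ell i0)%N.

Let L := (\max_(i < t) ell i)%N.
Let c : R := s 1%N * L%:R ^+ 2 / kappa i0.

Lemma rec0 : s 0%N = 1. Proof. by case: s_rec. Qed.

Lemma recS n : s n.+1 = \sum_(i < t) child_term (i < t')%N (kappa i) (ell i) s n.
Proof. by case: s_rec => _ ->; rewrite // next_termE. Qed.

Lemma rec_gt0 n : 0 < s n.
Proof.
elim/ltn_ind: n => -[|n] IH; first by rewrite rec0.
(* The induction hypothesis covers only indices up to [n]; [s'] agrees with [s] there and is
   nonnegative everywhere, as the [child_term] lemmas require. *)
pose s' k := Num.max (s k) 0.
have s'0 : forall k, 0 <= s' k by move=> k; rewrite le_max lexx orbT.
have s's k : (k <= n)%N -> s' k = s k by move=> kn; apply/max_idPl/ltW/IH.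
case: s_rec => _ -> //=; rewrite -(next_term_local t' ell kappa s's) next_termE.
have [|x xn xE] := @composition_pair R s' _ n 0 _ ell_i0; first by rewrite s's // rec0.
rewrite addn0 in x xn xE.
rewrite (bigD1 i0) //= ltr_pwDl //; last first.
  by apply: sumr_ge0 => i _; apply: child_term_ge0 => //; apply: ltW.
apply: (lt_le_trans _ (child_term_ge _ (ltW (kappa_gt0 i0)) s'0 xn)).
by rewrite xE !s's // rec0 mulr1 mulr_gt0 ?IH.
Qed.

Let rec_ge0 n : 0 <= s n. Proof. exact/ltW/rec_gt0. Qed.

Lemma ell_le_max i : (ell i <= L)%N. Proof. exact: leq_bigmax. Qed.

Let L_ge2 : (2 <= L)%N. Proof. exact: leq_trans ell_i0 (ell_le_max i0). Qed.

Lemma rec_join m n : kappa i0 * (s m * s n) <= s (m + n).+1.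
Proof.
have [x xn <-] := @composition_pair R s _ m n rec0 ell_i0.
rewrite recS (bigD1 i0) //= -[leLHS]addr0 lerD //.
  by apply: child_term_ge => //; apply: ltW.
by apply: sumr_ge0 => i _; apply: child_term_ge0 => //; apply: ltW.
Qed.

(** Summing [child_term_split] over [i] reassembles the [child_term]s at [N - a] into the term of
    [s] for the remaining tree. *)
Lemma rec_splits M N : (0 < M)%N -> (M < N)%N -> splits L M s N.
Proof.
move=> M0; elim/ltn_ind: N => -[//|N] IH; rewrite ltnS => MN.
rewrite /splits recS.
have le_i (i : 'I_t) : true -> child_term (i < t')%N (kappa i) (ell i) s N <=
    \sum_(a < M.+1 | (M <= L * a)%N) (leaves L (N.+1 - a))%:R *
      (s a * child_term (i < t')%N (kappa i) (ell i) s (N - a)).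
  move=> _; apply: child_term_split => //; rewrite ?rec0 //; first exact: ltW.
  - exact: ell_le_max.
  - by move=> k Mk kN; apply: IH.
apply: (le_trans (ler_sum _ le_i)); rewrite exchange_big /=.
apply: ler_sum => a _; rewrite -mulr_sumr -mulr_sumr subSn ?recS //.
by rewrite (leq_trans _ MN) // -ltnS.
Qed.

Lemma rec_step n : s n.+1 <= (leaves L n)%:R * s 1%N * s n.
Proof.
case: n => [|n]; first by rewrite rec0 mulr1 /leaves muln0 mul1r.
(* With [M = 1] only [a = 1] survives, as [a = 0] fails [M <= L * a]: a lowest internal vertex is
   detached. *)
have := @rec_splits 1 n.+2 isT isT; rewrite /splits !big_mkcond !big_ord_recl.
by rewrite big_ord0 /= muln0 add0r muln1 (ltnW L_ge2) addr0 mulrA subn1.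
Qed.

Lemma rec_step_le n : (0 < n)%N -> s n.+1 <= L%:R * n%:R * s 1%N * s n.
Proof.
move=> n0; apply: (le_trans (rec_step n)); rewrite ler_wpM2r // ler_wpM2r //.
by rewrite -natrM ler_nat /leaves; nia.
Qed.

(** Joining adds a root; deleting a lowest vertex restores the size [m + n]. *)
Lemma rec_glue m n : (0 < m + n)%N ->
  s m * s n <= s 1%N * L%:R / kappa i0 * (m + n)%:R * s (m + n)%N.
Proof.
move=> mn; rewrite -(ler_pM2l (kappa_gt0 i0)).
apply: (le_trans (rec_join m n)); apply: (le_trans (rec_step_le mn)).
by rewrite le_eqVlt; apply/orP; left; apply/eqP; field; rewrite gt_eqF.
Qed.

Lemma rec_const_ge1 : 1 <= c.
Proof.
rewrite /c ler_pdivlMr // mul1r.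
have ks : kappa i0 <= s 1%N.
  by have := rec_join 0 0; rewrite rec0 !mulr1.
have L1 : 1 <= L%:R ^+ 2 :> R by rewrite -natrX ler1n expn_gt0 (ltnW L_ge2).
by rewrite (le_trans ks) // ler_peMr.
Qed.

(** * Cutting into two prescribed sizes *)

(* [d] bounds the number of rounds: the size minus one, [(m + n).-1], shrinks by
   the factor [L / (L + 1)] each time.  Without the [-1] the larger piece could
   exceed that fraction because of rounding. *)
Lemma rec_submult_iter N0 d m n : (0 < N0)%N -> (m + n <= N0)%N ->
  ((m + n).-1 * L ^ d < L.+1 ^ d)%N ->
  s (m + n)%N <= (c * N0%:R ^+ 3) ^+ d * (s m * s n).
Proof.
move=> N00; set K := c * _.
have N01 : 1 <= N0%:R :> R by rewrite ler1n.
have K1 : 1 <= K by rewrite mulr_ege1 ?rec_const_ge1 // exprn_ege1.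
have K0 : 0 <= K by apply: le_trans K1.
have submult0 p q e : (p == 0)%N || (q == 0)%N -> s (p + q)%N <= K ^+ e * (s p * s q).
  have Ke : 1 <= K ^+ e by apply: exprn_ege1.
  by case/orP => /eqP ->; rewrite rec0 ?addn0 ?mul1r ?mulr1 ler_peMl.
elim: d m n => [|d IH] m n mnN0 sz.
  (* With no rounds left, [sz] forces [m + n <= 1], so one size is 0. *)
  by apply: submult0; move: sz; rewrite !expn0 muln1; lia.
have [/submult0 -> //|] := boolP ((m == 0)%N || (n == 0)%N).
rewrite negb_or -!lt0n => /andP[m0 n0].
set N := (m + n)%N in mnN0 sz *.
have N2 : (2 <= N)%N by rewrite /N; lia.
pose M := (L * N %/ L.+1)%N.
have ML : (M * L.+1 <= L * N)%N by apply: leq_divM.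
have LM : (L * N < M.+1 * L.+1)%N by rewrite ltn_ceil.
have M0 : (0 < M)%N by nia.
have MN : (M < N)%N by nia.
have small p : (p.-1 * L.+1 <= L * N.-1)%N -> (p.-1 * L ^ d < L.+1 ^ d)%N.
  move=> pN; rewrite -(ltn_pmul2r (ltn0Sn L)) -expnSr; apply: leq_ltn_trans sz.
  by rewrite expnS mulnAC [leqRHS]mulnA [(N.-1 * L)%N]mulnC leq_mul2r pN orbT.
pose G := s 1%N * L%:R / kappa i0 * N0%:R.
have G0 : 0 <= G by rewrite mulr_ge0 ?ler0n // divr_ge0 ?mulr_ge0 ?ler0n // ltW.
have glue p q : (0 < p + q)%N -> (p + q <= N0)%N -> s p * s q <= G * s (p + q)%N.
  move=> pq0 pqN; apply: (le_trans (rec_glue pq0)); rewrite ler_wpM2r //.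
  by rewrite ler_wpM2l ?ler_nat // divr_ge0 ?mulr_ge0 ?ler0n // ltW.
have piece (a : 'I_M.+1) : (M <= L * a)%N ->
    (leaves L (N - a))%:R * (s a * s (N - a)%N) <=
    (L%:R * N0%:R) * (G * K ^+ d * (s m * s n)).
  move=> MLa; have aM : (a <= M)%N by rewrite -ltnS.
  have a0 : (0 < a)%N by nia.
  (* This lower bound on [a] puts [N - a] within reach of [small], as [a <= M] does for [a]
     itself. *)
  have Na : (N <= a * L.+1 + 1)%N by nia.
  rewrite ler_pM ?ler0n ?mulr_ge0 //.
    by rewrite -natrM ler_nat /leaves; nia.
  (* If [a <= n], cut the other piece into [m] and [n - a] and glue the latter to
     [a]; otherwise cut [a] into [n] and [a - n]. *)
  have [an|na] := leqP a n.
    have E : (N - a = m + (n - a))%N by rewrite /N; lia.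
    have le1 : s (N - a)%N <= K ^+ d * (s m * s (n - a)%N).
      rewrite E; apply: IH; first by rewrite /N in mnN0; lia.
      by apply: small; rewrite -E; nia.
    have le2 : s a * s (n - a)%N <= G * s n.
      by rewrite -[in leRHS](subnKC an) glue ?subnKC //; rewrite /N in mnN0; lia.
    apply: (le_trans (ler_wpM2l (rec_ge0 a) le1)).
    have -> : s a * (K ^+ d * (s m * s (n - a)%N)) =
              (K ^+ d * s m) * (s a * s (n - a)%N) by ring.
    have -> : G * K ^+ d * (s m * s n) = (K ^+ d * s m) * (G * s n) by ring.
    by rewrite ler_wpM2l // mulr_ge0 // exprn_ge0.
  have E : (a = n + (a - n) :> nat)%N by lia.
  have E' : (m = (a - n) + (N - a))%N by rewrite /N; rewrite /N in MN; lia.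
  have le1 : s a <= K ^+ d * (s n * s (a - n)%N).
    rewrite {1}E; apply: IH; first by lia.
    by apply: small; rewrite -E; nia.
  have le2 : s (a - n)%N * s (N - a)%N <= G * s m.
    by rewrite [in leRHS]E' glue //; rewrite -E' //; rewrite /N in mnN0; lia.
  apply: (le_trans (ler_wpM2r (rec_ge0 _) le1)).
  have -> : K ^+ d * (s n * s (a - n)%N) * s (N - a)%N =
            (K ^+ d * s n) * (s (a - n)%N * s (N - a)%N) by ring.
  have -> : G * K ^+ d * (s m * s n) = (K ^+ d * s n) * (G * s m) by ring.
  by rewrite ler_wpM2l // mulr_ge0 // exprn_ge0.
apply: (le_trans (rec_splits M0 MN)); apply: (le_trans (ler_sum _ piece)).
rewrite sumr_const -[leLHS]mulr_natl.
(* The three factors [N0] in [K] come from the number of sizes [a], the leaf count and [G]; the last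
   two also supply [L ^ 2]. *)
have -> : K ^+ d.+1 * (s m * s n) =
    N0%:R * (L%:R * N0%:R * (G * K ^+ d * (s m * s n))).
  by rewrite exprS /K /c /G; field; rewrite gt_eqF.
have P0 : 0 <= L%:R * N0%:R * (G * K ^+ d * (s m * s n)).
  apply: mulr_ge0; first exact: mulr_ge0.
  by apply: mulr_ge0; apply: mulr_ge0 => //; apply: exprn_ge0.
apply: ler_wpM2r => //; rewrite ler_nat.
by rewrite (leq_trans (max_card _)) // card_ord (leq_trans MN).
Qed.

(** * Doubling in logarithmic form *)

Let b : R := (L%:R + 1) / L%:R.

Let L_gt0 : 0 < L%:R :> R. Proof. by rewrite ltr0n (ltnW L_ge2). Qed.

Let b_gt0 : 0 < b. Proof. by rewrite divr_gt0 // addr_gt0. Qed.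

Lemma ln_base_gt0 : 0 < ln b.
Proof. by apply: ln_gt0; rewrite /b ltr_pdivlMr // mul1r ltrDl. Qed.

(** [L >= 2] gives [b <= 3 / 2]; this is the hypothesis [beta <= T - l] of [rate_doubling]. *)
Lemma ln_base_le : ln b <= ln 3 - ln 2.
Proof.
have p32 : 0 < 3 / 2 :> R by lra.
rewrite -ln_div ?posrE ?ltr0n // ler_ln ?posrE ?b_gt0 //.
rewrite /b ler_pdivrMr // mulrAC ler_pdivlMr ?ltr0n //.
have : 2 <= L%:R :> R by rewrite ler_nat.
by lra.
Qed.

Let c_gt0 : 0 < c. Proof. exact: lt_le_trans ltr01 rec_const_ge1. Qed.

Lemma ln_rec_double n : (0 < n)%N ->
  ln (s (2 * n)%N) <= (ln c + 3 * ln (2 * n)%:R) * (ln (2 * n)%:R + ln b) / ln b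
                      + 2 * ln (s n).
Proof.
move=> n0; set N := (2 * n)%N.
have N0 : (0 < N)%N by rewrite muln_gt0.
have NR : 0 < N%:R :> R by rewrite ltr0n.
have lnN : 0 <= ln N%:R :> R by rewrite ln_ge0 // ler1n.
have lb0 := ln_base_gt0.
(* The least number of rounds with [b ^ d > N]. *)
pose d := (Num.trunc (ln N%:R / ln b)).+1.
have dgt : ln N%:R < ln (b ^+ d).
  by rewrite lnXn // -[ltRHS]mulr_natr mulrC -ltr_pdivrMr // truncnS_gt.
have dle : d%:R <= (ln N%:R + ln b) / ln b.
  rewrite mulrDl divff ?gt_eqF // /d -natr1 lerD2r truncn_le.
  by rewrite divr_ge0 // ltW.
have sz : ((n + n).-1 * L ^ d < L.+1 ^ d)%N.
  apply: (@leq_ltn_trans (N * L ^ d)); first by rewrite leq_mul2r /N; lia.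
  move: dgt; rewrite ltr_ln ?posrE ?exprn_gt0 // /b expr_div_n.
  by rewrite ltr_pdivlMr ?exprn_gt0 // natr1 -!natrX -natrM ltr_nat.
have le_nn : (n + n <= N)%N by rewrite /N; lia.
have K0 : 0 < c * N%:R ^+ 3 by rewrite mulr_gt0 ?exprn_gt0.
have := rec_submult_iter N0 le_nn sz.
rewrite (_ : (n + n)%N = N); last by rewrite /N; lia.
rewrite -ler_ln ?posrE ?rec_gt0 ?mulr_gt0 ?exprn_gt0 ?rec_gt0 //.
move=> /le_trans; apply.
have N3 : 0 < N%:R ^+ 3 :> R by rewrite exprn_gt0.
have sn := rec_gt0 n; have ss : 0 < s n * s n by rewrite mulr_gt0.
rewrite (lnM (exprn_gt0 d K0) ss) (lnXn d K0) (lnM c_gt0 N3) (lnM sn sn) (lnXn 3 NR).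
rewrite [2 * ln (s n)]mulr_natl mulr2n lerD2r.
rewrite -[leLHS]mulr_natr -[ln N%:R *+ 3]mulr_natl -[leRHS]mulrA ler_wpM2l //.
by rewrite addr_ge0 ?mulr_ge0 ?ler0n // ln_ge0 // rec_const_ge1.
Qed.

(* The logarithm of the expression under the root in the upper bound. *)
Definition log_bound (n : nat) : R :=
  (ln 3 * (18 * ln 3 + 2 * ln c) +
     ln n%:R * (3 * ln n%:R + 12 * ln 3 + ln c)) / ln b + ln (s n).

Lemma log_bound_double n : (0 < n)%N -> log_bound (2 * n) <= 2 * log_bound n.
Proof.
move=> n0; have := ln_rec_double n0; rewrite /log_bound.
have lnn : 0 <= ln n%:R :> R by rewrite ln_ge0 // ler1n.
have C0 : 0 <= ln c by rewrite ln_ge0 // rec_const_ge1.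
have l2 : 0 <= ln 2 :> R by rewrite ln_ge0 // ler1n.
have := rate_doubling ln_base_gt0 l2 lnn C0 ln_base_le.
have -> : ln (2 * n)%:R = ln 2 + ln n%:R :> R.
  by rewrite natrM lnM ?posrE ?ltr0n.
by move=> /=; lra.
Qed.

(** By [log_bound_double], the quotient of [log_bound] by its index does not increase along
    [2 ^ k * n]; and [log_bound] dominates [ln (s _)], its other summand being nonnegative. *)
Lemma ln_rec_pow2 n k : (0 < n)%N ->
  ln (s (2 ^ k * n)%N) <= log_bound n / n%:R * (2 ^ k * n)%:R.
Proof.
move=> n0; have nR : n%:R != 0 :> R by rewrite pnatr_eq0 -lt0n.
have -> : log_bound n / n%:R * (2 ^ k * n)%:R = 2 ^+ k * log_bound n.
  by rewrite natrM natrX; field.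
have le_bound : ln (s (2 ^ k * n)%N) <= log_bound (2 ^ k * n).
  rewrite lerDr divr_ge0 ?(ltW ln_base_gt0) //.
  have C0 : 0 <= ln c by rewrite ln_ge0 // rec_const_ge1.
  have l3 : 0 <= ln 3 :> R by rewrite ln_ge0 // ler1n.
  have lnn : 0 <= ln (2 ^ k * n)%:R :> R.
    by rewrite ln_ge0 // ler1n muln_gt0 expn_gt0.
  by do ![apply: addr_ge0 | apply: mulr_ge0].
apply: (le_trans le_bound); elim: k {le_bound} => [|k IH].
  by rewrite expn0 mul1n expr0 mul1r.
rewrite expnS -mulnA exprS -mulrA.
apply: le_trans (log_bound_double _) _; first by rewrite muln_gt0 expn_gt0.
by rewrite ler_pM2l ?ltr0n.
Qed.

(** * Convergence and the two bounds *)

(** The index shift absorbs the root added by a join, so that sizes add exactly. *)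
Let g n := ln (kappa i0) + ln (s n.-1).

Let gD p q : (0 < p)%N -> (0 < q)%N -> g p + g q <= g (p + q)%N.
Proof.
case: p q => [//|p] [//|q] _ _; rewrite /g addSn addnS /= addrACA -addrA lerD2l.
rewrite -!lnM ?posrE ?rec_gt0 //; last by rewrite mulr_gt0 ?rec_gt0.
by rewrite ler_ln ?posrE ?mulr_gt0 ?rec_gt0 // rec_join.
Qed.

Let g_le n : (0 < n)%N -> g n <= ln (s n).
Proof.
case: n => [//|n] _; rewrite /g /= -lnM ?posrE ?rec_gt0 //.
rewrite ler_ln ?posrE ?mulr_gt0 ?rec_gt0 //.
by have := rec_join n 0; rewrite rec0 mulr1 addn0.
Qed.

Let g_bound n m : (0 < n)%N -> (0 < m)%N -> g m / m%:R <= log_bound n / n%:R.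
Proof.
move=> n0; apply: (superadditive_le gD n0) => k.
apply: le_trans (ln_rec_pow2 k n0); apply: g_le.
by rewrite muln_gt0 expn_gt0.
Qed.

Lemma ln_rec_cvg : exists rho : R, [/\ (fun n => ln (s n) / n%:R) @ \oo --> rho,
  forall n, (1 < n)%N ->
    ln (kappa i0 / (L%:R * (n%:R - 1) * s 1%N) * s n) / n%:R <= rho &
  forall n, (0 < n)%N -> rho <= log_bound n / n%:R].
Proof.
have [rho [g_cvg g_rho rho_le]] := superadditive_cvg gD (fun m => @g_bound 1 m isT).
exists rho; split.
- rewrite -cvg_shiftS /=.
  (* The shift keeps indices away from 0; passing from [g] to [ln (s _)] costs a factor tending to 1
     and a term tending to 0. *)
  have -> : (fun n => ln (s n.+1) / n.+1%:R) =
      (fun n => (g n.+2 / n.+2%:R) * (1 + n.+1%:R^-1) - ln (kappa i0) * n.+1%:R^-1).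
    apply/funext => n; rewrite /g /= -[n.+2%:R]natr1.
    have : 0 < n.+1%:R :> R by rewrite ltr0n.
    move: (n.+1%:R) => x x0; field.
    by rewrite !gt_eqF // addr_gt0.
  rewrite -[rho]mulr1 -[rho * 1]subr0 -[X in rho * X]addr0 -[X in _ - X](mulr0 (ln (kappa i0))).
  have harm : (fun n => n.+1%:R^-1) @ \oo --> (0 : R) by exact: cvg_harmonic.
  apply: cvgB; last by apply: cvgM harm; apply: cvg_cst.
  apply: cvgM; last by apply: cvgD harm; apply: cvg_cst.
  by rewrite (cvg_shiftS (fun n => g n.+1 / n.+1%:R)) (cvg_shiftS (fun n => g n / n%:R)).
- move=> n n1; have n0 := ltnW n1.
  apply: le_trans (g_rho n n0); rewrite ler_pM2r ?invr_gt0 ?ltr0n //.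
  have n1R : 0 < n%:R - 1 :> R by rewrite subr_gt0 ltr1n.
  have D0 : 0 < L%:R * (n%:R - 1) * s 1%N by rewrite !mulr_gt0 ?rec_gt0.
  rewrite /g -lnM ?posrE ?rec_gt0 //.
  rewrite ler_ln ?posrE ?(mulr_gt0 (divr_gt0 _ D0)) ?mulr_gt0 ?rec_gt0 //.
  rewrite -mulrA ler_pM2l // mulrC ler_pdivrMr // mulrC.
  have := @rec_step_le n.-1; rewrite prednK // -subn1 subn_gt0 natrB // => /(_ n1).
  by rewrite subn1.
- by move=> n n0; apply: rho_le => m m0; apply: g_bound.
Qed.

End Recurrence.

(** * From logarithms back to roots *)

Theorem theorem1 (R : realType) (t t' : nat) (ell : 'I_t -> nat)
    (kappa : 'I_t -> R) (s : nat -> R)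
    (ht : (1 <= t)%N) (ht' : (t' <= t)%N)
    (hell : forall i, (1 <= ell i)%N)
    (hell2 : exists i, (2 <= ell i)%N)
    (hkappa : forall i, 0 < kappa i)
    (hs : satisfies_recurrence t' ell kappa s) :
  let root_s := fun n : nat => nroot n (s n) in
  let lambda := limn root_s in
  let L : R := (\max_(i < t) ell i)%:R in
  let log := logb ((L + 1) / L) in
  cvgn root_s /\
  forall i0 : 'I_t, (2 <= ell i0)%N ->
  forall n : nat, (2 <= n)%N ->
    nroot n (kappa i0 / (L * (n%:R - 1) * s 1%N) * s n) <= lambda /\
    lambda <= nroot n
      (3 `^ (18 * log 3 + 2 * log (s 1%N * L ^+ 2 / kappa i0))
       * n%:R `^ (3 * log n%:R + 12 * log 3
                  + log (s 1%N * L ^+ 2 / kappa i0))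
       * s n).
Proof.
move=> root_s lambda L log.
have nrootE n (x : R) : 0 < x -> nroot n x = expR (ln x / n%:R).
  by move=> x0; rewrite /nroot /powR gt_eqF // mulrC.
have lim i0 (hi0 : (2 <= ell i0)%N) rho :
    (fun n => ln (s n) / n%:R) @ \oo --> rho -> root_s @ \oo --> expR rho.
  move=> cv; have -> : root_s = expR \o (fun n => ln (s n) / n%:R).
    by apply/funext => n; rewrite /= -nrootE // (rec_gt0 hkappa hs hi0).
  by apply: continuous_cvg cv; apply: continuous_expR.
split.
  have [i0 hi0] := hell2; have [rho [cv _ _]] := ln_rec_cvg hell hkappa hs hi0.
  by apply/cvg_ex; exists (expR rho); exact: (lim i0 hi0 _ cv).
move=> i0 hi0 n n2; have [rho [cv lower upper]] := ln_rec_cvg hell hkappa hs hi0.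
(* Each [i0] has its own [rho]; uniqueness of the limit ties them all to the same [lambda]. *)
have -> : lambda = expR rho by apply/cvg_lim => //; exact: (lim i0 hi0 _ cv).
have s0 := rec_gt0 hkappa hs hi0.
have n0 : 0 < n%:R :> R by rewrite ltr0n ltnW.
have L0 : 0 < L.
  by rewrite ltr0n; apply: leq_trans (ell_le_max ell i0); apply: hell.
have n1 : 0 < n%:R - 1 :> R by rewrite subr_gt0 ltr1n.
split; rewrite nrootE ?ler_expR; first exact: lower.
- by rewrite mulr_gt0 // divr_gt0 // !mulr_gt0.
- have P3 x : 0 < 3 `^ x :> R by rewrite powR_gt0.
  have Pn x : 0 < n%:R `^ x :> R by rewrite powR_gt0.
  rewrite !lnM ?posrE ?mulr_gt0 // !ln_powR.
  (* The two bounds coincide once [log x] is written as [ln x / ln b]. *)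
  apply: le_trans (upper n (ltnW n2)) _; rewrite le_eqVlt; apply/orP; left.
  apply/eqP; congr (_ / _); rewrite /log_bound /log /logb; congr (_ + _); ring.
- by rewrite !mulr_gt0 ?powR_gt0.
Qed.
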